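(* For $n\in\mathbb N$ let $K_n$ be the complete graph with vertex set $\{1,2,\ldots,n\}$, and let $\Gamma_K=\bigsqcup_{n\in\mathbb N}K_n$ be the disjoint union of all these graphs. Then $\Gamma_K$ is approximately uniformly locally finite (AULF).
   Context: All graphs are simple (no loops or multiple edges) and locally finite (every vertex has finitely many adjacent vertices), but not necessarily connected. $\mathbb N=\{1,2,3,\ldots\}$. For a graph $\Gamma$ with vertex set $V$, $d(v)$ is the degree of $v\in V$, $v\sim w$ means that $v$ and $w$ are adjacent, and $l^2(\Gamma)$ is the Hilbert space of square-summable complex functions on $V$, with orthonormal basis $\{\delta_v\}_{v\in V}$ of characteristic functions of vertices (the standard basis). The normalized Laplacian $L$ of $\Gamma$ is the bounded operator on $l^2(\Gamma)$ given by $Lf(v)=f(v)-\sum_{w\sim v}\frac{1}{\sqrt{d(v)d(w)}}f(w)$ (the sum is empty if $v$ is isolated). For $d\in\mathbb N$, $\mathbb B^{(d)}$ is the set of bounded operators on $l^2(\Gamma)$ whose matrix with respect to the standard basis has at most $d$ non-zero entries in each row and in each column. Put $\mathbb B^{(\infty)}=\bigcup_{d\in\mathbb N}\mathbb B^{(d)}$ and let $\mathbb B$ be the closure of $\mathbb B^{(\infty)}$ in the operator norm. The graph $\Gamma$ is approximately uniformly locally finite (AULF) if $L\in\mathbb B$. *)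

(* Defs.v *)
From HB Require Import structures.
From mathcomp Require Import all_boot all_order all_algebra.
From mathcomp Require Import finmap complex ring lra.
From mathcomp Require Import all_classical all_reals ereal esum.

Set Implicit Arguments.
Unset Strict Implicit.
Unset Printing Implicit Defensive.

Import Order.TTheory GRing.Theory Num.Theory Normc.

Local Open Scope classical_set_scope.
Local Open Scope ring_scope.
Local Open Scope complex_scope.
Local Open Scope card_scope.

Record lfgraph := LFGraph {
  vertex :> choiceType;
  adj : rel vertex;
  adj_sym : symmetric adj;
  adj_irrefl : irreflexive adj;
  adj_finite : forall v, finite_set [set w | adj v w] }.

Definition nbhd (G : lfgraph) (v : G) : set G := [set w | adj v w].

Definition degree (G : lfgraph) (v : G) : nat := #|` fset_set (nbhd v)|.

Section CompleteGraph.
Variable n : nat.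

Definition complete_adj : rel 'I_n := fun i j => i != j.

Lemma complete_adj_sym : symmetric complete_adj.
Proof. by move=> i j; rewrite /complete_adj eq_sym. Qed.

Lemma complete_adj_irrefl : irreflexive complete_adj.
Proof. by move=> i; rewrite /complete_adj eqxx. Qed.

Lemma complete_adj_finite i : finite_set [set j | complete_adj i j].
Proof. exact: finite_finset. Qed.

(* The vertex set {1, ..., n} is encoded as 'I_n = {0, ..., n - 1}. *)
Definition complete_graph : lfgraph :=
  LFGraph complete_adj_sym complete_adj_irrefl complete_adj_finite.

End CompleteGraph.

Section DisjointUnion.
Variables (I : choiceType) (G : I -> lfgraph).

Definition union_adj : rel {i : I & G i} :=
  fun x y => (tag x == tag y) && adj (tagged x) (tagged_as x y).

Lemma union_adj_sym : symmetric union_adj.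
Proof.
have H x y : union_adj x y -> union_adj y x.
  case: x y => [i v] [j w] /andP[/= /eqP ij].
  case: _ / ij in w *; rewrite tagged_asE => vw.
  by rewrite /union_adj /= eqxx tagged_asE adj_sym.
by move=> x y; apply/idP/idP; exact: H.
Qed.

Lemma union_adj_irrefl : irreflexive union_adj.
Proof. by move=> [i v]; rewrite /union_adj /= eqxx tagged_asE adj_irrefl. Qed.

Lemma union_adj_finite x : finite_set [set y | union_adj x y].
Proof.
case: x => i v.
apply: (@sub_finite_set _ _ (@existT _ (fun i => G i : Type) i @` nbhd v)).
  move=> [j w] /andP[/= /eqP ij].
  case: _ / ij in w *; rewrite tagged_asE => vw.
  by exists w.
exact/finite_image/adj_finite.
Qed.

Definition disjoint_union : lfgraph :=
  LFGraph union_adj_sym union_adj_irrefl union_adj_finite.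

End DisjointUnion.

Section L2.
Variables (R : realType) (V : choiceType).
Implicit Types f g : V -> R[i].

Definition sqsum f : \bar R := \esum_(v in [set: V]) (normc (f v) ^+ 2)%:E.

Definition l2_pred : {pred V -> R[i]} := fun f => (sqsum f < +oo)%E.

Record l2 := L2 { l2_fun :> V -> R[i]; l2P : l2_fun \in l2_pred }.

HB.instance Definition _ := [isSub for l2_fun].
HB.instance Definition _ := [Choice of l2 by <:].

Lemma sqsum_ge0 f : (0 <= sqsum f)%E.
Proof. by apply: esum_ge0 => v _; rewrite lee_fin sqr_ge0. Qed.

Lemma normc_ge0 (z : R[i]) : 0 <= normc z.
Proof. by case: z => a b; exact: sqrtr_ge0. Qed.

Lemma normcD_sqr (x y : R[i]) :
  normc (x + y) ^+ 2 <= 2 * normc x ^+ 2 + 2 * normc y ^+ 2.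
Proof.
apply: (@le_trans _ _ ((normc x + normc y) ^+ 2)).
  by rewrite lerXn2r ?nnegrE ?addr_ge0 ?normc_ge0 ?le_normcD.
have := sqr_ge0 (normc x - normc y); nra.
Qed.

Lemma esumZl (c : R) (a : V -> \bar R) :
  0 <= c -> (forall v, 0 <= a v)%E ->
  (\esum_(v in [set: V]) (c%:E * a v) <= c%:E * \esum_(v in [set: V]) a v)%E.
Proof.
move=> c0 a0; apply: ge_ereal_sup => _ [F [finF _] <-].
rewrite fsbig_finite// -ge0_sume_distrr//.
apply: lee_wpmul2l; first by rewrite lee_fin.
rewrite -fsbig_finite//; apply: ereal_sup_ubound; exists F => //.
Qed.

Lemma sqsumD f g : (sqsum (f + g)%R <= 2%:E * sqsum f + 2%:E * sqsum g)%E.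
Proof.
apply: (@le_trans _ _ (\esum_(v in [set: V])
  (2%:E * (normc (f v) ^+ 2)%:E + 2%:E * (normc (g v) ^+ 2)%:E))%E).
  apply: le_esum => v _.
  by rewrite -!EFinM -EFinD lee_fin; exact: normcD_sqr.
rewrite esumD; first last.
- by move=> v _; rewrite -EFinM lee_fin mulr_ge0// sqr_ge0.
- by move=> v _; rewrite -EFinM lee_fin mulr_ge0// sqr_ge0.
by apply: leeD; apply: esumZl => // v; rewrite lee_fin sqr_ge0.
Qed.

Lemma sqsumZ (c : R[i]) f : (sqsum (c *: f)%R <= (normc c ^+ 2)%:E * sqsum f)%E.
Proof.
apply: le_trans (esumZl _ _); last 2 first.
- exact: sqr_ge0.
- by move=> v; rewrite lee_fin sqr_ge0.
by apply: le_esum => v _; rewrite -EFinM lee_fin normcM exprMn.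
Qed.

Lemma l2_submod_closed : submod_closed l2_pred.
Proof.
split=> [|c f g].
  rewrite unfold_in /sqsum esum1// => v _.
  by rewrite normc0 expr0n.
rewrite !unfold_in => f2 g2.
apply: le_lt_trans (sqsumD _ _) _.
rewrite lte_add_pinfty// lte_mul_pinfty//.
apply: le_lt_trans (sqsumZ _ _) _.
by rewrite lte_mul_pinfty// lee_fin sqr_ge0.
Qed.

HB.instance Definition _ := GRing.isSubmodClosed.Build _ _ l2_pred
  l2_submod_closed.
HB.instance Definition _ := [SubChoice_isSubLmodule of l2 by <:].

Definition l2norm (f : l2) : R := Num.sqrt (fine (sqsum f)).

Lemma l2_delta_subproof (v : V) : (fun w => (w == v)%:R : R[i]) \in l2_pred.
Proof.
rewrite unfold_in /sqsum.
rewrite (esumID [set v]) ?setTI; last first.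
  by move=> w _; rewrite lee_fin sqr_ge0.
rewrite esum_set1 ?lee_fin ?sqr_ge0// esum1 ?adde0 ?ltry//.
move=> w /= wv; have /negPf -> : w != v by apply/eqP => /wv.
by rewrite normc0 expr0n.
Qed.

Definition delta (v : V) : l2 := L2 (l2_delta_subproof v).

End L2.

Section Operators.
Variables (R : realType) (V : choiceType).
Local Notation H := (l2 R V).

Definition bounded_op (T : H -> H) : Prop :=
  exists M : R, forall f, l2norm (T f) <= M * l2norm f.

Definition opnorm (T : H -> H) : \bar R :=
  ereal_sup [set (l2norm (T f))%:E | f in [set f | l2norm f <= 1]].

(* The coordinate of [T (delta w)] at [v], that is, <T delta_w, delta_v>. *)
Definition mxcoef (T : H -> H) (v w : V) : R[i] := T (delta R w) v.

Definition BB_ (d : nat) : set {linear H -> H} :=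
  [set T | [/\ bounded_op T,
    forall v, [set w | mxcoef T v w != 0] #<= `I_d &
    forall w, [set v | mxcoef T v w != 0] #<= `I_d]].

Definition BBinfty : set {linear H -> H} :=
  \bigcup_(d in [set d | (0 < d)%N]) BB_ d.

Definition BB : set {linear H -> H} :=
  [set T | bounded_op T /\
    forall e : R, 0 < e -> exists2 S, BBinfty S & (opnorm (T \- S)%R < e%:E)%E].

End Operators.

Section Laplacian.
Variables (R : realType) (G : lfgraph).
Implicit Types f : G -> R[i].

Definition normadj_fun f (v : G) : R[i] :=
  \sum_(w \in nbhd v)
    (Num.sqrt ((degree v)%:R * (degree w)%:R))^-1%:C * f w.

Definition laplacian_fun f (v : G) : R[i] := f v - normadj_fun f v.

Lemma normadj_fun_linear (c : R[i]) f g :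
  normadj_fun (c *: f + g) = c *: normadj_fun f + normadj_fun g.
Proof.
apply/funext => v.
rewrite [RHS](_ : _ = c * normadj_fun f v + normadj_fun g v)//.
rewrite /normadj_fun !fsbig_finite; do ?exact: adj_finite.
rewrite mulr_sumr -big_split /=; apply: eq_bigr => w _.
by rewrite [(c *: f + g) w](_ : _ = c * f w + g w)// mulrDr mulrCA.
Qed.

Lemma laplacian_fun_linear (c : R[i]) f g :
  laplacian_fun (c *: f + g) = c *: laplacian_fun f + laplacian_fun g.
Proof.
apply/funext => v; rewrite /laplacian_fun normadj_fun_linear.
rewrite [LHS](_ : _ =
  (c * f v + g v) - (c * normadj_fun f v + normadj_fun g v))//.
rewrite [RHS](_ : _ =
  c * (f v - normadj_fun f v) + (g v - normadj_fun g v))//.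
by rewrite mulrBr opprD addrACA.
Qed.

Lemma sum_sqr_aux (s : seq G) (b : G -> R) (a : R) :
  2 * a * (\sum_(w <- s) b w) <= (size s)%:R * a ^+ 2 + \sum_(w <- s) b w ^+ 2.
Proof.
elim: s => [|w s IH]; first by rewrite !big_nil mulr0 mul0r addr0.
rewrite !big_cons /= -natr1.
have := sqr_ge0 (a - b w); nra.
Qed.

Lemma sqr_sum_le (s : seq G) (b : G -> R) :
  (\sum_(w <- s) b w) ^+ 2 <= (size s)%:R * \sum_(w <- s) b w ^+ 2.
Proof.
elim: s => [|w s IH]; first by rewrite !big_nil expr0n mul0r.
rewrite !big_cons /= -natr1.
have := sum_sqr_aux s b (b w); nra.
Qed.

Lemma adjacency_sqr f (v : G) : normc (normadj_fun f v) ^+ 2 <=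
  \sum_(w <- fset_set (nbhd v)) normc (f w) ^+ 2 / (degree w)%:R.
Proof.
rewrite /normadj_fun fsbig_finite; last exact: adj_finite.
set s := fset_set _.
pose b w := (Num.sqrt ((degree v)%:R * (degree w)%:R))^-1 * normc (f w).
apply: (@le_trans _ _ ((\sum_(w <- s) b w) ^+ 2)).
  rewrite lerXn2r ?nnegrE ?normc_ge0//.
    by apply: sumr_ge0 => w _; rewrite mulr_ge0 ?normc_ge0// invr_ge0 sqrtr_ge0.
  elim/big_ind2 : _ => [|x1 x2 y1 y2 h1 h2|w _]; first by rewrite normc0.
    exact: le_trans (le_normcD _ _) (lerD h1 h2).
  rewrite normcM /b; apply: ler_wpM2r; first exact: normc_ge0.
  by rewrite /= expr0n addr0 sqrtr_sqr ger0_norm// invr_ge0 sqrtr_ge0.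
apply: le_trans (sqr_sum_le _ _) _.
rewrite mulr_sumr le_eqVlt; apply/orP; left; apply/eqP.
rewrite [LHS]big_seq [RHS]big_seq; apply: eq_bigr => w ws.
rewrite -/(degree v) /b exprMn exprVn sqr_sqrtr ?mulr_ge0 ?ler0n// invfM.
have dv0 : (degree v)%:R != 0 :> R.
  by rewrite pnatr_eq0 -lt0n /degree -/s; case: (enum_fset s) ws.
by rewrite !mulrA mulfV// mul1r -mulrA mulrC -expr2.
Qed.

Lemma adjacency_deg (F : set G) (w : G) (c : R) : finite_set F -> 0 <= c ->
  (\sum_(v <- fset_set F) (if adj v w then (c / (degree w)%:R)%:E else 0)
    <= c%:E)%E.
Proof.
move=> finF c0; rewrite -big_mkcond /= sumEFin lee_fin.
rewrite big_const_seq iter_addr_0 -[leLHS]mulr_natr -mulrA ler_piMr//.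
set k := count _ _.
have kd : (k <= degree w)%N.
  rewrite /k -size_filter; apply: uniq_leq_size.
    by rewrite filter_uniq.
  move=> v; rewrite mem_filter => /andP[vw _].
  by rewrite in_fset_set ?inE /nbhd /= 1?adj_sym//; exact: adj_finite.
have [d0|d0] := posnP (degree w); first by rewrite d0 invr0 mul0r.
by rewrite mulrC ler_pdivrMr ?ltr0n// mul1r ler_nat.
Qed.

Lemma sqsum_adjacency f : (sqsum (normadj_fun f) <= sqsum f)%E.
Proof.
pose a v w : \bar R :=
  if adj v w then (normc (f w) ^+ 2 / (degree w)%:R)%:E else 0%E.
have a0 v w : (0 <= a v w)%E.
  by rewrite /a; case: ifP => // _; rewrite lee_fin divr_ge0 ?sqr_ge0.
apply: ge_ereal_sup => _ [F [finF _] <-].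
rewrite fsbig_finite//=.
apply: (@le_trans _ _ (\sum_(v <- fset_set F) \esum_(w in [set: G]) a v w)%E).
  apply: lee_sum => v _.
  apply: (@le_trans _ _
    (\sum_(w <- fset_set (nbhd v)) (normc (f w) ^+ 2 / (degree w)%:R)%:E)%E).
    by rewrite sumEFin lee_fin; exact: adjacency_sqr.
  rewrite -fsbig_finite; last exact: adj_finite.
  rewrite -esum_fset; [|exact: adj_finite|]; last first.
    by move=> w _; rewrite lee_fin divr_ge0 ?sqr_ge0.
  rewrite esum_mkcond; apply: le_esum => w _.
  rewrite /a; case: ifPn => [|_]; last first.
    by case: ifP => // _; rewrite lee_fin divr_ge0 ?sqr_ge0.
  by rewrite inE /nbhd /= => ->.
rewrite -esum_sum//; apply: le_esum => w _.
by apply: adjacency_deg => //; exact: sqr_ge0.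
Qed.

Lemma sqsum_laplacian f : (sqsum (laplacian_fun f) <= 4%:E * sqsum f)%E.
Proof.
have -> : laplacian_fun f = f + (-1) *: normadj_fun f.
  by rewrite scaleN1r.
apply: le_trans (sqsumD _ _) _.
have -> : (4%:E * sqsum f = 2%:E * sqsum f + 2%:E * sqsum f)%E.
  by rewrite -ge0_muleDl ?lee_fin// -EFinD -natrD.
apply: leeD => //; apply: lee_wpmul2l; first by rewrite lee_fin.
apply: le_trans (sqsumZ _ _) _.
by rewrite normcN normc1 expr1n mul1e sqsum_adjacency.
Qed.

Lemma laplacian_subproof (f : l2 R G) : laplacian_fun f \in @l2_pred R G.
Proof.
rewrite unfold_in; apply: le_lt_trans (sqsum_laplacian _) _.
by rewrite lte_mul_pinfty ?lee_fin//; have := l2P f; rewrite unfold_in.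
Qed.

Definition laplacian (f : l2 R G) : l2 R G := L2 (laplacian_subproof f).

Lemma laplacian_is_linear : linear laplacian.
Proof. by move=> c f g; apply: val_inj; exact: laplacian_fun_linear. Qed.

HB.instance Definition _ :=
  GRing.isLinear.Build R[i] (l2 R G) (l2 R G) _ laplacian laplacian_is_linear.

Lemma laplacian_bounded : bounded_op laplacian.
Proof.
exists 2 => f.
have fin g : sqsum (g : l2 R G) \is a fin_num.
  by rewrite ge0_fin_numE ?sqsum_ge0//; have := l2P g; rewrite unfold_in.
have -> : 2 = Num.sqrt 4 :> R.
  by rewrite (_ : 4 = 2 ^+ 2) ?sqrtr_sqr ?ger0_norm// expr2 -natrM.
rewrite /l2norm -sqrtrM// ler_wsqrtr//.
by rewrite -lee_fin EFinM !fineK//; exact: sqsum_laplacian.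
Qed.

End Laplacian.

Definition AULF (R : realType) (G : lfgraph) : Prop :=
  BB (@laplacian R G : {linear l2 R G -> l2 R G}).

(* Main.v *)
Require Import Defs.
From HB Require Import structures.
From mathcomp Require Import all_boot all_order all_algebra.
From mathcomp Require Import finfield finmap complex ring lra zify.
From mathcomp Require Import all_classical all_reals ereal esum.

(** On the clique [K_N] with [N > 1] the Laplacian is a combination of the identity
    and of the projection [f |-> mean f] onto the constants, with coefficients at
    most [2]. So it is enough to approximate these projections in norm, uniformly
    in [N], by matrices with a bounded number of non-zero entries in each row and
    column, and to assemble the blocks: an operator that is block diagonal along
    the cliques is as bounded, and as sparse, as its blocks uniformly are.

    Sparse approximations of the mean are expanders. A family of [D] permutations
    of [X] defines a walk operator, the average of the permutations; it has at most
    [D] non-zero entries in each row and column, and the family expands with error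
    [e] if the walk is within [e] of the mean in operator norm. Composing walks
    multiplies errors ([mixing_comp]), so a family of expanders with bounded [D]
    and a fixed error below [1] yields every error.

    Such a family is built with the zig-zag product. If the steps of a first walk,
    of error [e], are indexed by the vertices of a second one, of error [d], then
    the product has error at most [e + 2 d], and its number of steps depends on the
    second walk only ([mixing_zigzag]). The proof is the triangle inequality.
    Alternating squaring, which improves the error, and zig-zag products with one
    fixed walk, which restore the number of steps, gives walks on [2 ^ (216 t)]
    points with [2 ^ 96] steps and error [1 / 2] for all [t]
    ([expander_exists]). The fixed walk comes from the incidence of points and lines
    in a plane over a finite field, whose error is the inverse square root of the
    order of the field because two points with distinct first coordinates lie on
    exactly one line ([mixing_line_step]).

    A set of arbitrary size [N] is the image of a set of [2 ^ (216 t)] points under a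
    map with non-empty fibres of bounded size. Compressing the walk along this map,
    with suitable weights, gives a sparse matrix close to the mean on [N] points
    ([compress_mixing], [sparse_mean]). *)

Set Implicit Arguments.
Unset Strict Implicit.
Unset Printing Implicit Defensive.

Import Order.TTheory GRing.Theory Num.Theory Normc.

Local Open Scope ring_scope.

(** * The Euclidean norm on functions over a finite type *)

Section FiniteNorm.
Variable R : realType.

Definition ssq (X : finType) (f : X -> R) : R := \sum_x f x ^+ 2.
Definition nrm (X : finType) (f : X -> R) : R := Num.sqrt (ssq f).
Definition mean (X : finType) (f : X -> R) : R := (\sum_x f x) / #|X|%:R.

Lemma ssq_ge0 (X : finType) (f : X -> R) : 0 <= ssq f.
Proof. by apply: sumr_ge0 => x _; exact: sqr_ge0. Qed.

Lemma nrm_ge0 (X : finType) (f : X -> R) : 0 <= nrm f.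
Proof. exact: sqrtr_ge0. Qed.

Lemma sqr_nrm (X : finType) (f : X -> R) : nrm f ^+ 2 = ssq f.
Proof. by rewrite sqr_sqrtr ?ssq_ge0. Qed.

Lemma nrm_le (X Y : finType) (f : X -> R) (g : Y -> R) (c : R) : 0 <= c ->
  (nrm f <= c * nrm g) = (ssq f <= c ^+ 2 * ssq g).
Proof.
move=> c0; rewrite -[LHS]ler_sqr ?nnegrE ?mulr_ge0 ?nrm_ge0//.
by rewrite exprMn !sqr_nrm.
Qed.

Lemma cauchy_schwarz (X : finType) (f g : X -> R) :
  (\sum_x f x * g x) ^+ 2 <= ssq f * ssq g.
Proof.
set c := \sum_x _; have [g0|g0] := eqVneq (ssq g) 0.
  suff -> : c = 0 by rewrite expr0n mulr_ge0 ?ssq_ge0.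
  rewrite /c big1// => x _; move/eqP: g0.
  rewrite /ssq psumr_eq0 => [/allP/(_ x)|y _]; last exact: sqr_ge0.
  by rewrite mem_index_enum sqrf_eq0 => /(_ isT)/eqP ->; rewrite mulr0.
have gp : 0 < ssq g by rewrite lt_def g0 ssq_ge0.
have : 0 <= \sum_x (ssq g * f x - c * g x) ^+ 2.
  by apply: sumr_ge0 => x _; exact: sqr_ge0.
have sqrBE (a b : R) : \sum_x (a * f x - b * g x) ^+ 2 =
    a ^+ 2 * ssq f - 2 * a * b * c + b ^+ 2 * ssq g.
  rewrite /c /ssq !mulr_sumr -sumrN -!big_split /=.
  by apply: eq_bigr => x _; ring.
have -> : \sum_x (ssq g * f x - c * g x) ^+ 2 = ssq g * (ssq f * ssq g - c ^+ 2).
  by rewrite sqrBE; ring.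
by rewrite pmulr_rge0// subr_ge0.
Qed.

Lemma nrmZ (X : finType) (c : R) (f : X -> R) :
  nrm (fun x => c * f x) = `|c| * nrm f.
Proof.
rewrite /nrm -sqrtr_sqr -sqrtrM ?sqr_ge0// /ssq mulr_sumr.
by congr Num.sqrt; apply: eq_bigr => x _; rewrite exprMn.
Qed.

Lemma nrmD (X : finType) (f g : X -> R) :
  nrm (fun x => f x + g x) <= nrm f + nrm g.
Proof.
rewrite -ler_sqr ?nnegrE ?addr_ge0 ?nrm_ge0// sqrrD !sqr_nrm.
have -> : ssq (fun x => f x + g x) = ssq f + 2 * \sum_x f x * g x + ssq g.
  rewrite /ssq mulr_sumr -!big_split /=.
  by apply: eq_bigr => x _; ring.
rewrite lerD2r lerD2l -[leRHS]mulr_natl ler_pM2l//.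
apply: le_trans (ler_norm _) _.
rewrite -ler_sqr ?nnegrE ?mulr_ge0 ?nrm_ge0// real_normK ?num_real//.
by rewrite exprMn !sqr_nrm cauchy_schwarz.
Qed.

Lemma sqr_sum_card (X : finType) (P : pred X) (f : X -> R) :
  (\sum_(x | P x) f x) ^+ 2 <= #|P|%:R * \sum_(x | P x) f x ^+ 2.
Proof.
have := cauchy_schwarz (fun x => (P x)%:R) (fun x => (P x)%:R * f x).
have E (h : X -> R) : \sum_x (P x)%:R * h x = \sum_(x | P x) h x.
  rewrite [RHS]big_mkcond; apply: eq_bigr => x _.
  by case: ifP; rewrite ?mul1r ?mul0r.
have F x : (P x)%:R * (P x)%:R = (P x)%:R :> R by rewrite -natrM mulnb andbb.
rewrite /ssq; under eq_bigr do rewrite mulrA F.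
under [X in _ <= X * _]eq_bigr do rewrite expr2 F -[(P _)%:R]mulr1.
under [X in _ <= _ * X]eq_bigr do rewrite exprMn {1}expr2 F.
by rewrite !E sumr_const.
Qed.

Lemma sum_pairE (X Y : finType) (f : X * Y -> R) :
  \sum_p f p = \sum_x \sum_y f (x, y).
Proof. by rewrite pair_bigA; apply: eq_bigr => -[]. Qed.

Lemma ssq_pair (X Y : finType) (f : X * Y -> R) :
  ssq f = \sum_x ssq (fun y => f (x, y)).
Proof. exact: sum_pairE. Qed.

Lemma sum_mean (X : finType) (f : X -> R) : \sum_x f x = #|X|%:R * mean f.
Proof.
rewrite /mean; have [X0|X0] := eqVneq (#|X|%:R : R) 0; last first.
  by rewrite mulrC divfK.
rewrite X0 mul0r big1// => x _.
move/eqP: X0; rewrite pnatr_eq0 => /eqP/card0_eq/(_ x).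
by rewrite inE.
Qed.

Lemma ssq_mean_le (X : finType) (f : X -> R) : #|X|%:R * mean f ^+ 2 <= ssq f.
Proof.
have [X0|X0] := posnP #|X|; first by rewrite X0 mul0r ssq_ge0.
have Xp : 0 < (#|X|%:R : R) by rewrite ltr0n.
rewrite -(ler_pM2l Xp) mulrA -expr2 -exprMn -sum_mean.
exact: (sqr_sum_card xpredT f).
Qed.

Lemma ssq_inj (X : finType) (h : X -> X) (f : X -> R) :
  injective h -> ssq (fun x => f (h x)) = ssq f.
Proof. by move=> hi; rewrite /ssq [RHS](reindex_inj hi). Qed.

Lemma ssq_center (X : finType) (f : X -> R) :
  ssq (fun x => f x - mean f) = ssq f - #|X|%:R * mean f ^+ 2.
Proof.
transitivity (ssq f - 2 * mean f * \sum_x f x + #|X|%:R * mean f ^+ 2).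
  rewrite /ssq mulr_sumr -sumrN [X in _ + X]mulr_natl -sumr_const -!big_split /=.
  by apply: eq_bigr => x _; ring.
by rewrite sum_mean; ring.
Qed.

Lemma nrm_mean (X : finType) (f : X -> R) : nrm (fun _ : X => mean f) <= nrm f.
Proof.
rewrite -[leRHS]mul1r nrm_le// expr1n mul1r; apply: le_trans (ssq_mean_le f).
by rewrite /ssq sumr_const mulr_natl.
Qed.

Lemma mean_cst (X : finType) (c : R) : (0 < #|X|)%N -> mean (fun _ : X => c) = c.
Proof.
by move=> X0; rewrite /mean sumr_const -[X in X / _]mulr_natr mulfK// pnatr_eq0 -lt0n.
Qed.

Lemma meanB (X : finType) (f g : X -> R) :
  mean (fun x => f x - g x) = mean f - mean g.
Proof. by rewrite /mean sumrB mulrBl. Qed.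

Lemma exchange_mean (X Y : finType) (f : X -> Y -> R) :
  mean (fun x => mean (f x)) = mean (fun y => mean (fun x => f x y)).
Proof.
by rewrite /mean -!mulr_suml exchange_big -!mulrA [_^-1 * _]mulrC.
Qed.

Lemma mean_pair (X Y : finType) (f : X * Y -> R) :
  mean f = mean (fun x => mean (fun y => f (x, y))).
Proof.
rewrite /mean card_prod natrM invfM -mulr_suml pair_bigA -mulrA [_^-1 * _]mulrC.
by congr (_ * _); apply: eq_bigr => -[].
Qed.

Lemma mean_inj (X Y : finType) (h : X -> Y) (f : Y -> R) :
  injective h -> #|X| = #|Y| -> mean (fun x => f (h x)) = mean f.
Proof.
move=> hi XY; rewrite /mean XY; congr (_ / _).
have [g hg gh] : bijective h by apply: inj_card_bij; rewrite // XY.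
by rewrite [RHS](reindex h)//; exists g => x _.
Qed.

End FiniteNorm.

(** * Random walks and expanders *)

Section Expanders.
Variable R : realType.

Definition walk (X J : finType) (s : J -> X -> X) (f : X -> R) (x : X) : R :=
  mean (fun i => f (s i x)).

(** The walk is an average of permutations of the coordinates. *)
Lemma walk_contract (X J : finType) (s : J -> X -> X) (f : X -> R) :
  (forall i, injective (s i)) -> nrm (walk s f) <= nrm f.
Proof.
move=> si; rewrite -[leRHS]mul1r nrm_le// expr1n mul1r.
have [J0|J0] := posnP #|J|.
  rewrite {1}/ssq big1 ?ssq_ge0// => x _.
  by rewrite /walk /mean J0 invr0 mulr0 expr0n.
have Jp : 0 < (#|J|%:R : R) by rewrite ltr0n.
rewrite -(ler_pM2l Jp) /ssq mulr_sumr.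
apply: (@le_trans _ _ (\sum_x ssq (fun i => f (s i x)))).
  by apply: ler_sum => x _; exact: ssq_mean_le.
rewrite /ssq exchange_big /=.
under eq_bigr => i _ do rewrite -/(ssq (fun x => f (s i x))) ssq_inj//.
by rewrite sumr_const mulr_natl.
Qed.

Lemma mean_walk (X J : finType) (s : J -> X -> X) (f : X -> R) :
  (0 < #|J|)%N -> (forall i, injective (s i)) -> mean (walk s f) = mean f.
Proof.
move=> J0 si; rewrite exchange_mean.
rewrite (_ : (fun i => _) = fun=> mean f) ?mean_cst//.
by apply/funext => i; rewrite mean_inj.
Qed.

(** For a doubly stochastic walk this bounds by [e] the operator norm of the walk
    on the functions of mean zero, that is, its second singular value. *)
Definition mixing (X J : finType) (s : J -> X -> X) (e : R) :=
  forall f : X -> R, nrm (fun x => walk s f x - mean f) <= e * nrm f.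

(** Sizes are recorded as exponents of two: the products and powers below then
    only add exponents, and no large number is ever computed. *)
Definition expander (a b : nat) (e : R) :=
  exists (X J : finType) (s : J -> X -> X),
    [/\ #|X| = (2 ^ a)%N, #|J| = (2 ^ b)%N, forall i, injective (s i)
      & mixing s e].

Lemma expander_le (a b : nat) (e e' : R) :
  e <= e' -> expander a b e -> expander a b e'.
Proof.
move=> ee' [X [J [s [cX cJ si sm]]]]; exists X, J, s; split=> // f.
by apply: le_trans (sm f) _; rewrite ler_wpM2r// nrm_ge0.
Qed.

Lemma expander_point (b : nat) : expander 0 b 0.
Proof.
exists unit, 'I_(2 ^ b), (fun _ x => x).
split=> [||i|f]; rewrite ?card_unit ?card_ord//.
rewrite mul0r /nrm /ssq big1 ?sqrtr0// => x _.
rewrite /walk mean_cst ?card_ord ?expn_gt0//.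
rewrite (_ : f = fun=> f tt) ?mean_cst ?card_unit ?subrr ?expr0n//.
by apply/funext => -[].
Qed.

(** An additional random choice that the step ignores does not change the walk;
    this adjusts the number of steps to the size required by a zig-zag product. *)
Lemma expander_pad (a b k : nat) (e : R) :
  expander a b e -> expander a (b + k) e.
Proof.
move=> [X [J [s [cX cJ si sm]]]].
exists X, (J * 'I_(2 ^ k))%type, (fun i => s i.1).
split=> //; first by rewrite card_prod card_ord cJ expnD.
move=> f; suff -> : walk (fun i : J * 'I_(2 ^ k) => s i.1) f = walk s f.
  exact: sm.
apply/funext => x; rewrite /walk mean_pair /=.
by congr mean; apply/funext => i; rewrite mean_cst// card_ord expn_gt0.
Qed.

(** Subtracting the mean from [walk t f] leaves a function of norm at most
    [e' * nrm f] and of mean zero, which the walk of [s] contracts by [e]. *)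
Lemma mixing_comp (X J K : finType) (s : J -> X -> X) (t : K -> X -> X)
    (e e' : R) : 0 <= e -> (0 < #|J|)%N -> (0 < #|K|)%N ->
  (forall i, injective (t i)) ->
  mixing s e -> mixing t e' ->
  mixing (fun ij : J * K => t ij.2 \o s ij.1) (e * e').
Proof.
move=> e0 J0 K0 ti sm tm f; pose h x := walk t f x - mean f.
have -> : (fun x => walk (fun ij : J * K => t ij.2 \o s ij.1) f x - mean f) =
          (fun x => walk s h x - mean h).
  apply/funext => x; rewrite /walk mean_pair /= /h !meanB mean_cst//.
  case: (posnP #|X|) => [/card0_eq/(_ x)|X0]; first by rewrite inE.
  by rewrite mean_cst// mean_walk// subrr subr0.
apply: le_trans (sm h) _; rewrite -mulrA ler_wpM2l//; exact: tm.
Qed.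

Lemma expander_square (a b : nat) (e : R) : 0 <= e ->
  expander a b e -> expander a (b + b) (e ^+ 2).
Proof.
move=> e0 [X [J [s [cX cJ si sm]]]].
have J0 : (0 < #|J|)%N by rewrite cJ expn_gt0.
exists X, (J * J)%type, (fun ij => s ij.2 \o s ij.1); split=> //.
- by rewrite card_prod cJ expnD.
- by move=> ij; exact: inj_comp.
- by rewrite expr2; exact: mixing_comp.
Qed.

(** This bounds an operator of the form [1 (x) T] by the norm of [T]. *)
Lemma nrm_fiber (X Y : finType) (f g : X * Y -> R) (e : R) : 0 <= e ->
  (forall x, nrm (fun y => f (x, y)) <= e * nrm (fun y => g (x, y))) ->
  nrm f <= e * nrm g.
Proof.
move=> e0 fg; rewrite nrm_le// !ssq_pair mulr_sumr; apply: ler_sum => x _.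
by rewrite -nrm_le.
Qed.

Lemma nrm_fst (X Y : finType) (g : X -> R) :
  nrm (fun p : X * Y => g p.1) = Num.sqrt #|Y|%:R * nrm g.
Proof.
rewrite /nrm -sqrtrM ?ler0n// ssq_pair /ssq mulr_sumr; congr Num.sqrt.
by apply: eq_bigr => x _; rewrite /= sumr_const mulr_natl.
Qed.

Lemma nrm_fiber_mean (X Y : finType) (f : X * Y -> R) :
  Num.sqrt #|Y|%:R * nrm (fun x => mean (fun y => f (x, y))) <= nrm f.
Proof.
rewrite -nrm_fst -[leRHS]mul1r; apply: nrm_fiber => // x /=.
rewrite nrm_le// expr1n mul1r; apply: le_trans (ssq_mean_le _).
by rewrite /ssq /= sumr_const mulr_natl.
Qed.

(** The zig-zag product: the steps of [s] are indexed by the vertices of [t], and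
    a step of the product walks in [Y], uses the point reached to move in [X],
    and walks in [Y] again. *)
Definition zigzag (X Y K : finType) (s : Y -> X -> X) (t : K -> Y -> Y)
    (k : K * K) (p : X * Y) : X * Y :=
  let y := t k.1 p.2 in (s y p.1, t k.2 y).

Lemma zigzag_inj (X Y K : finType) (s : Y -> X -> X) (t : K -> Y -> Y) k :
  (forall y, injective (s y)) -> (forall k, injective (t k)) ->
  injective (zigzag s t k).
Proof.
by move=> si ti [x y] [x' y'] [/= + /ti/ti yy]; rewrite yy => /si ->.
Qed.

(** With [W] the walk of [t] and [P] the averaging over [Y] in each fibre, and
    [U] the permutation that moves in [X], the product walk is [W U W]. Replacing
    each [W] by [P] costs [d], since [W], [P] and [U] are contractions, and [P U P]
    is the walk of [s] acting on fibrewise means. *)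
Lemma mixing_zigzag (X Y K : finType) (s : Y -> X -> X) (t : K -> Y -> Y)
    (e d : R) : (0 < #|Y|)%N -> (0 < #|K|)%N -> 0 <= e -> 0 <= d ->
  (forall y, injective (s y)) -> (forall k, injective (t k)) ->
  mixing s e -> mixing t d -> mixing (zigzag s t) (e + d *+ 2).
Proof.
move=> Y0 K0 e0 d0 si ti sm tm f.
pose lift (T : (Y -> R) -> Y -> R) (g : X * Y -> R) p :=
  T (fun y => g (p.1, y)) p.2.
pose W := lift (walk t); pose P := lift (fun g _ => mean g).
pose U (g : X * Y -> R) p := g (s p.2 p.1, p.2).
have WP g : nrm (fun p => W g p - P g p) <= d * nrm g.
  by apply: nrm_fiber => // x; exact: (tm (fun y => g (x, y))).
have nW g : nrm (W g) <= nrm g.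
  rewrite -[leRHS]mul1r; apply: nrm_fiber => // x.
  by rewrite mul1r; exact: walk_contract.
have nP g : nrm (P g) <= nrm g.
  by rewrite [leLHS](nrm_fst _ (fun x => mean (fun y => g (x, y)))) nrm_fiber_mean.
have nU g : nrm (U g) = nrm g.
  rewrite /nrm (ssq_inj (h := fun p => (s p.2 p.1, p.2)))//.
  by move=> [x y] [x' y'] [/= + yy]; rewrite yy => /si ->.
have zE p : walk (zigzag s t) f p = W (U (W f)) p.
  rewrite /walk mean_pair.
  by case: p.
pose g x := mean (fun y => f (x, y)).
have PUP p : P (U (P f)) p = walk s g p.1 by [].
have -> : (fun p => walk (zigzag s t) f p - mean f) =
  (fun p => (W (U (W f)) p - P (U (W f)) p +
     P (U (fun p => W f p - P f p)) p) + (walk s g p.1 - mean g)).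
  apply/funext => p; rewrite zE mean_pair -/g -PUP.
  by rewrite /P /lift /U /= meanB; ring.
apply: le_trans (nrmD _ _) _.
apply: (@le_trans _ _ ((d * nrm f + d * nrm f) + e * nrm f)); last by
  rewrite mulrDl mulr2n mulrDl addrC.
apply: lerD; first apply: le_trans (nrmD _ _) (lerD _ _).
- apply: le_trans (WP _) _; rewrite ler_wpM2l// nU; exact: nW.
- by apply: le_trans (nP _) _; rewrite nU; exact: WP.
rewrite (nrm_fst _ (fun x => walk s g x - mean g)).
apply: le_trans (ler_wpM2l (sqrtr_ge0 _) (sm g)) _.
by rewrite mulrCA ler_wpM2l//; exact: nrm_fiber_mean.
Qed.

Lemma card_eq_inj (X Y : finType) : #|X| = #|Y| ->
  exists h : X -> Y, injective h.
Proof.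
move=> XY; exists (fun x => enum_val (cast_ord XY (enum_rank x))).
by move=> x y /enum_val_inj/cast_ord_inj/enum_rank_inj.
Qed.

Lemma expander_zigzag (a b c : nat) (e d : R) : 0 <= e -> 0 <= d ->
  expander a c e -> expander c b d -> expander (a + c) (b + b) (e + d *+ 2).
Proof.
move=> e0 d0 [X [J [s [cX cJ si sm]]]] [Y [K [t [cY cK ti tm]]]].
have [h hi] : exists h : Y -> J, injective h.
  by apply: card_eq_inj; rewrite cY cJ.
exists (X * Y)%type, (K * K)%type, (zigzag (fun y => s (h y)) t); split.
- by rewrite card_prod cX cY expnD.
- by rewrite card_prod cK expnD.
- by move=> k; exact: zigzag_inj.
apply: mixing_zigzag => //; rewrite ?cY ?cK ?expn_gt0// => f.
suff -> : walk (fun y => s (h y)) f = walk s f by exact: sm.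
apply/funext => x; rewrite /walk (mean_inj (fun i => f (s i x)))//.
by rewrite cY cJ.
Qed.

End Expanders.

(** * Expanders from points and lines *)

Section Lines.
Variable R : realType.

(** The steps from [(a, b)] lead to the points of the non-vertical line
    [y = a x + b]; writing [x = a + i] makes each step a permutation of [F * F]. *)
Definition line_step (F : finFieldType) (i : F) (p : F * F) : F * F :=
  (p.1 + i, p.1 * (p.1 + i) + p.2).

Lemma line_step_inj (F : finFieldType) (i : F) : injective (line_step i).
Proof. by move=> [a b] [a' b'] [/addIr -> /addrI ->]. Qed.

Lemma two_points_one_line (F : finFieldType) (x y : F) : x != y ->
  injective (fun p : F * F => (p.1 * x + p.2, p.1 * y + p.2)).
Proof.
move=> xy [a b] [a' b'] [/= E1 E2].
have /eqP : (a - a') * (x - y) = 0.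
  transitivity ((a * x + b) - (a' * x + b') - ((a * y + b) - (a' * y + b'))).
    by ring.
  by rewrite E1 E2 !subrr.
rewrite mulf_eq0 !subr_eq0 (negPf xy) orbF => /eqP aa.
by move: E1; rewrite aa => /addrI ->.
Qed.

(** Expanding the square counts the non-vertical lines through pairs of points:
    exactly one if the first coordinates differ, [#|F|] if the points are equal,
    and none if they are distinct with the same first coordinate. *)
Lemma ssq_line_sum (F : finFieldType) (f : F * F -> R) :
  ssq (fun p => \sum_x f (x, p.1 * x + p.2)) =
    #|F|%:R * ssq f + (\sum_p f p) ^+ 2 - \sum_x (\sum_y f (x, y)) ^+ 2.
Proof.
pose col x := \sum_y f (x, y).
pose C x y := \sum_(p : F * F) f (x, p.1 * x + p.2) * f (y, p.1 * y + p.2).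
have Cd x : C x x = #|F|%:R * \sum_y f (x, y) ^+ 2.
  rewrite /C sum_pairE mulr_natl -sumr_const; apply: eq_bigr => a _ /=.
  by rewrite [RHS](reindex_inj (addrI (a * x))).
have Cn x y : x != y -> C x y = col x * col y.
  move=> xy; rewrite /col big_distrlr /=.
  rewrite -(sum_pairE (fun p => f (x, p.1) * f (y, p.2))).
  rewrite (reindex_inj (two_points_one_line xy)) /=.
  by apply: eq_bigr.
have -> : ssq (fun p => \sum_x f (x, p.1 * x + p.2)) = \sum_x \sum_y C x y.
  rewrite /ssq /C; under [RHS]eq_bigr do rewrite exchange_big.
  rewrite [RHS]exchange_big; apply: eq_bigr => p _.
  by rewrite expr2 big_distrlr.
have -> : (\sum_p f p) ^+ 2 = \sum_x \sum_y col x * col y.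
  by rewrite sum_pairE expr2 big_distrlr.
rewrite ssq_pair mulr_sumr -sumrN -!big_split /=; apply: eq_bigr => x _.
rewrite (bigD1 x)//= [in RHS](bigD1 x)//= Cd -/(col x).
under eq_bigr => y yx do rewrite Cn 1?eq_sym//.
by rewrite /ssq; ring.
Qed.

Lemma mixing_line_step (F : finFieldType) (e : R) :
  0 <= e -> #|F|%:R * e ^+ 2 = 1 -> mixing (@line_step F) e.
Proof.
move=> e0 qe f; set q : R := #|F|%:R.
have q0 : q != 0 by apply/eqP => q0; move: qe; rewrite -/q q0; lra.
have F0 : (0 < #|F|)%N by rewrite lt0n; move: q0; rewrite pnatr_eq0.
rewrite nrm_le//.
rewrite -(mean_walk f F0 (@line_step_inj F)) ssq_center (mean_walk _ F0 (@line_step_inj F)).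
have wE : walk (@line_step F) f = (fun p => q^-1 * \sum_x f (x, p.1 * x + p.2)).
  apply/funext => -[a b].
  rewrite /walk /line_step /= (mean_inj (fun x => f (x, a * x + b)) (@addrI _ a))//.
  by rewrite /mean mulrC.
have -> : ssq (walk (@line_step F) f) =
    q ^- 2 * (q * ssq f + (\sum_p f p) ^+ 2 - \sum_x (\sum_y f (x, y)) ^+ 2).
  rewrite wE -ssq_line_sum /ssq mulr_sumr; apply: eq_bigr => p _.
  by rewrite exprMn exprVn.
have -> : e ^+ 2 = q^-1 by rewrite -[LHS](mulKf q0) qe mulr1.
rewrite sum_mean card_prod natrM -/q.
have : 0 <= q ^- 2 * \sum_x (\sum_y f (x, y)) ^+ 2.
  by rewrite mulr_ge0 ?invr_ge0 ?sqr_ge0// sumr_ge0// => x _; exact: sqr_ge0.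
set s := \sum_x _ => s0; rewrite -subr_ge0; apply: le_trans s0 _.
by rewrite le_eqVlt; apply/orP; left; apply/eqP; field.
Qed.

(** The field has [2 ^ (2 * r)] elements, so that the inverse square root of its
    order is a power of [1 / 2]. *)
Lemma expander_lines (r : nat) : (0 < r)%N ->
  expander (4 * r) (2 * r) (2^-1 ^+ r : R).
Proof.
move=> r0; have r20 : (0 < 2 * r)%N by rewrite muln_gt0.
have [F _ cF] := pPrimePowerField (isT : prime 2) r20.
exists (F * F)%type, F, (@line_step F); split => //.
- by rewrite card_prod cF -expnD; congr (2 ^ _)%N; lia.
- by move=> i; exact: line_step_inj.
apply: mixing_line_step; first by rewrite exprn_ge0// invr_ge0.
by rewrite cF -exprM [(r * 2)%N]mulnC natrX -exprMn mulfV ?expr1n ?pnatr_eq0.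
Qed.

End Lines.

(** * Expanders of all sizes *)

Section ExpanderFamily.
Variable R : realType.

(** The recursion in [expander_exists] needs at least [d ^ 4] points for [d] steps
    and an error at most [1 / 8], where lines give only [d ^ 2] points. Zig-zag
    products of line walks of increasing size reach [d ^ 3], then [d ^ (9 / 2)];
    the fields are large enough for the accumulated errors to stay below [1 / 8]. *)
Lemma expander_base : expander 216 48 (8^-1 : R).
Proof.
have H r : (0 < r)%N -> expander (4 * r) (2 * r) (2^-1 ^+ r : R).
  exact: expander_lines.
have p r : 0 <= 2^-1 ^+ r :> R by rewrite exprn_ge0// invr_ge0.
have h1 := expander_zigzag (p _) (p _) (H 12 isT) (H 6 isT).
have h2 := expander_zigzag (p _) _ (H 36 isT) h1.
apply: expander_le (h2 _).
- by have := p 36; lra.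
- by have := p 12; have := p 6; lra.
Qed.

(** Squaring the walk and taking the zig-zag product with the walk of
    [expander_base] multiplies the number of points by [2 ^ 216] and returns to
    [2 ^ 96] steps, because [2 * 96 + 24 = 216] and [2 * 48 = 96]. The error bound
    [1 / 2] reproduces itself: [(1 / 2) ^ 2 + 2 * (1 / 8) = 1 / 2]. *)
Lemma expander_exists (t : nat) : expander (216 * t) 96 (2^-1 : R).
Proof.
elim: t => [|t IH].
  by apply: expander_le (expander_point R 96); rewrite invr_ge0.
have h0 : 0 <= 2^-1 :> R by rewrite invr_ge0.
have h := expander_pad 24 (expander_square h0 IH).
rewrite mulnS addnC.
apply: expander_le (expander_zigzag _ _ h expander_base);
  rewrite ?exprn_ge0 ?invr_ge0//.
by lra.
Qed.

Lemma expander_pow (a b k : nat) (e : R) : 0 <= e ->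
  expander a b e -> expander a (b * 2 ^ k) (e ^+ (2 ^ k)).
Proof.
move=> e0 h; elim: k => [|k IH]; first by rewrite muln1 expr1.
rewrite expnSr mulnA muln2 -addnn exprM.
by apply: expander_square => //; rewrite exprn_ge0.
Qed.

Lemma small_pow (e : R) : 0 < e -> exists k, 2^-1 ^+ (2 ^ k) <= e.
Proof.
move=> e0.
have [k] : exists k : nat, e^-1 < k%:R.
  by exists (Num.truncn e^-1).+1; exact: truncnS_gt.
move=> ke; exists k; rewrite exprVn -[leRHS]invrK lef_pV2 ?posrE ?invr_gt0 ?exprn_gt0//.
apply: le_trans (ltW ke) _; rewrite -natrX ler_nat.
by apply: leq_trans (ltnW (ltn_expl _ _)) (ltnW (ltn_expl _ _)).
Qed.

End ExpanderFamily.

(** * Sparse approximation of the mean on any finite set *)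

Section Compression.
Variable R : realType.

Definition kop (X : finType) (K : X -> X -> R) (g : X -> R) (x : X) : R :=
  \sum_y K x y * g y.

Definition sparse_kernel (d : nat) (X : finType) (K : X -> X -> R) :=
  forall x, (#|[set y | K x y != 0%R]| <= d)%N /\ (#|[set y | K y x != 0%R]| <= d)%N.

Section Fibers.
Variables (X Y J : finType) (s : J -> X -> X) (phi : X -> Y).
Hypothesis si : forall k, injective (s k).

Let m y := #|[set x | phi x == y]|.
Let ratio : R := #|X|%:R / #|Y|%:R.

(** With [m] the fibre sizes and [v g x := g (phi x) / m (phi x)], this is the
    kernel of [g |-> ratio / m i * \sum_(phi x = i) walk s (v g) x]. The weights
    are chosen so that the mean on [X] in place of the walk yields the mean on
    [Y]. *)
Definition compress (i j : Y) : R :=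
  ratio / ((m i)%:R * (m j)%:R) *
  \sum_(x | phi x == i) mean (fun k => (phi (s k x) == j)%:R).

Lemma compress_neq0 i j : compress i j != 0 ->
  exists x k, phi x = i /\ phi (s k x) = j.
Proof.
apply: contra_neqP => /forallNP E.
rewrite /compress big1 ?mulr0// => x /eqP xi.
rewrite /mean big1 ?mul0r// => k _.
by case: eqP => // kj; case: (E x); exists k.
Qed.

Lemma compress_sparse (M : nat) : (forall y, m y <= M)%N ->
  sparse_kernel (M * #|J|) compress.
Proof.
move=> mM i; split.
  pose A := [set phi (s p.2 p.1) | p in finset.setX [set x | phi x == i] [set: J]].
  apply: (@leq_trans #|A|).
    apply: subset_leq_card; apply/fintype.subsetP => j.
    rewrite inE => /compress_neq0[x [k [xi kj]]].
    by apply/imsetP; exists (x, k); rewrite ?inE /= ?xi ?kj ?eqxx.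
  by rewrite (leq_trans (leq_imset_card _ _))// cardsX cardsT leq_mul2r mM orbT.
pose A := [set phi (invF (@si p.2) p.1) | p in finset.setX [set x | phi x == i] [set: J]].
apply: (@leq_trans #|A|).
  apply: subset_leq_card; apply/fintype.subsetP => j.
  rewrite inE => /compress_neq0[x [k [xj ki]]].
  by apply/imsetP; exists (s k x, k); rewrite ?inE /= ?invF_f ?ki ?xj ?eqxx.
by rewrite (leq_trans (leq_imset_card _ _))// cardsX cardsT leq_mul2r mM orbT.
Qed.

(** The lifting of [g] to [X] divides by the fibre sizes, and the sums over fibres
    are divided by them again, so both maps are contractions; only the factor
    [ratio] remains in front of the error of the walk. *)
Lemma compress_mixing (e : R) : 0 <= e -> (0 < #|J|)%N ->
  (forall y, 0 < m y)%N -> mixing s e ->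
  forall g, nrm (fun i => kop compress g i - mean g) <= ratio * e * nrm g.
Proof.
move=> e0 J0 m0 sm g.
have r0 : 0 <= ratio by rewrite divr_ge0.
have m1 y : 1 <= (m y)%:R :> R by rewrite ler1n.
have mp y : (m y)%:R != 0 :> R by rewrite pnatr_eq0 -lt0n.
pose v x := g (phi x) / (m (phi x))%:R.
have fiber_sum (F : X -> R) : \sum_x F x = \sum_y \sum_(x | phi x == y) F x.
  by rewrite (partition_big phi xpredT).
have fiber_cst y (c : R) : \sum_(x | phi x == y) c = (m y)%:R * c.
  by rewrite sumr_const mulr_natl /m cardsE.
have sumv : \sum_x v x = \sum_y g y.
  rewrite fiber_sum; apply: eq_bigr => y _.
  under eq_bigr => x /eqP xy do rewrite /v xy.
  by rewrite fiber_cst mulrC divfK.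
have ssqv : ssq v <= ssq g.
  rewrite [leLHS]fiber_sum; apply: ler_sum => y _.
  under eq_bigr => x /eqP xy do rewrite /v xy.
  rewrite fiber_cst exprMn exprVn mulrCA ler_piMr ?sqr_ge0//.
  by rewrite expr2 invfM mulrA mulfV// mul1r invf_le1 ?(lt_le_trans ltr01 (m1 _)).
pose h x := walk s v x - mean v.
have kE i : kop compress g i - mean g =
    ratio / (m i)%:R * \sum_(x | phi x == i) h x.
  rewrite sumrB mulrBr fiber_cst; congr (_ - _); last first.
    have X0 : #|X|%:R != 0 :> R.
      by rewrite pnatr_eq0 -lt0n (leq_trans (m0 i) (max_card _)).
    have Y0 : #|Y|%:R != 0 :> R.
      by rewrite pnatr_eq0 -lt0n; apply/card_gt0P; exists i.
    by rewrite mulrA divfK// /mean sumv /ratio; field; rewrite X0 Y0.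
  rewrite /kop /compress mulr_sumr.
  under eq_bigr => j _ do rewrite -mulrA mulr_suml mulr_sumr.
  rewrite exchange_big; apply: eq_bigr => x _ /=.
  rewrite /walk /mean !mulr_suml mulr_sumr.
  under eq_bigr => j _ do rewrite !mulr_suml mulr_sumr.
  rewrite exchange_big; apply: eq_bigr => k _ /=.
  rewrite (bigD1 (phi (s k x)))//= big1 ?addr0; last first.
    by move=> j; rewrite eq_sym => /negPf ->; rewrite !mul0r mulr0.
  by rewrite eqxx mul1r /v invfM; ring.
have -> : (fun i => kop compress g i - mean g) =
    (fun i => ratio / (m i)%:R * \sum_(x | phi x == i) h x) by apply/funext.
apply: (@le_trans _ _ (ratio * nrm h)).
  rewrite nrm_le// {1}/ssq [ssq h]fiber_sum mulr_sumr; apply: ler_sum => y _.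
  rewrite exprMn exprMn -mulrA ler_wpM2l ?sqr_ge0//.
  have := sqr_sum_card (fun x => phi x == y) h.
  rewrite (_ : #|_| = m y) => [sh|]; last by rewrite /m cardsE.
  have S0 : 0 <= \sum_(x | phi x == y) h x ^+ 2.
    by apply: sumr_ge0 => x _; exact: sqr_ge0.
  have mi0 : 0 <= (m y)%:R^-1 :> R by rewrite invr_ge0.
  apply: le_trans (ler_wpM2l (sqr_ge0 _) sh) _.
  rewrite mulrA expr2 -(mulrA _ _ (m y)%:R) mulVf// mulr1 ler_piMl//.
  by rewrite invf_le1 ?(lt_le_trans ltr01 (m1 _)).
rewrite -mulrA ler_wpM2l//; apply: le_trans (sm v) _.
by rewrite ler_wpM2l// ler_wsqrtr.
Qed.

End Fibers.

Lemma pow_between (M n : nat) : (1 < M)%N ->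
  exists t, (n < M ^ t)%N /\ (M ^ t <= M * n.+1)%N.
Proof.
move=> M1; exists (up_log M n.+1); split; first exact: up_logP.
case: n => [|n]; first by rewrite up_log1 muln1 ltnW.
have /andP[+ _] := up_log_bounds M1 (isT : 1 < n.+2)%N.
have : (0 < up_log M n.+2)%N by rewrite up_log_gt0 M1.
by case: (up_log _ _) => // k _ /= h; rewrite expnS leq_mul2l ltnW ?orbT.
Qed.

Lemma balanced_map (X : finType) (M n : nat) :
  (n < #|X|)%N -> (#|X| <= M * n.+1)%N ->
  exists phi : X -> 'I_n.+1, forall i,
    (0 < #|[set x | phi x == i]| <= M)%N.
Proof.
move=> nX XM.
(* the quotient by n.+1 separates the ranks in one residue class *)
exists (fun x => inord (enum_rank x %% n.+1)) => i.
apply/andP; split.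
  apply/card_gt0P; exists (enum_val (widen_ord nX i)).
  by rewrite inE enum_valK /= modn_small ?inord_val ?ltn_ord.
have M0 (x : X) : (enum_rank x %/ n.+1 < M)%N.
  by rewrite ltn_divLR//; exact: leq_trans (ltn_ord _) XM.
rewrite -[leqRHS]card_ord.
apply: (@leq_card_in _ _ (fun x => Ordinal (M0 x))).
move=> x y; rewrite !inE => /eqP xi /eqP yi [dxy].
apply/enum_rank_inj/val_inj => /=.
rewrite (divn_eq (enum_rank x) n.+1) (divn_eq (enum_rank y) n.+1) dxy.
congr (_ + _)%N; move/(congr1 val): (etrans xi (esym yi)).
by rewrite /= !inordK ?ltn_mod.
Qed.

(** The compression of a walk on [M ^ t] points loses a factor at most [M], so
    the walk is first iterated until its error is below [e / M]; the number of
    iterations depends on [e] only. *)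
Lemma sparse_mean (e : R) : 0 < e -> exists d, forall n,
  exists K : 'I_n.+1 -> 'I_n.+1 -> R, sparse_kernel d K /\
    forall g, nrm (fun i => kop K g i - mean g) <= e * nrm g.
Proof.
move=> e0.
(* M stands for 2 ^ 216, kept abstract so that it is never evaluated *)
have [M [b [M1 hM]]] : exists M b, (1 < M)%N /\ forall t,
    exists (X J : finType) (s : J -> X -> X), [/\ #|X| = (M ^ t)%N, #|J| = (2 ^ b)%N,
    forall i, injective (s i) & forall f, M%:R * nrm (fun x => walk s f x - mean f) <= e * nrm f].
  have p0 : 0 < (2 ^ 216)%:R :> R by rewrite ltr0n expn_gt0.
  have [k hk] := small_pow (divr_gt0 e0 p0).
  exists (2 ^ 216)%N, (96 * 2 ^ k)%N; split; first by rewrite (@ltn_exp2l 2 0).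
  move=> t; have h0 : 0 <= 2^-1 :> R by rewrite invr_ge0.
  have [X [J [s [cX cJ si sm]]]] := expander_pow k h0 (expander_exists R t).
  exists X, J, s; split=> // [|f]; first by rewrite cX expnM.
  rewrite -ler_pdivlMl// mulrA [_^-1 * _]mulrC; apply: le_trans (sm f) _.
  by rewrite ler_wpM2r ?nrm_ge0.
exists (M * 2 ^ b)%N => n.
have [t [nt tM]] := pow_between n M1.
have [X [J [s [cX cJ si sm]]]] := hM t.
rewrite -cX in nt tM; have [phi hphi] := balanced_map nt tM.
exists (compress s phi); split.
  by rewrite -cJ; apply: compress_sparse => // y; have /andP[] := hphi y.
move=> g.
have Mp : 0 < M%:R :> R by rewrite ltr0n ltnW.
have sm' : mixing s (e / M%:R).
  by move=> f; rewrite mulrAC ler_pdivlMr// mulrC.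
apply: le_trans (compress_mixing _ _ _ sm' g) _.
- by rewrite divr_ge0 ?ltW.
- by rewrite cJ expn_gt0.
- by move=> y; have /andP[] := hphi y.
rewrite ler_wpM2r ?nrm_ge0// mulrCA ler_piMr ?(ltW e0)// card_ord.
by rewrite ler_pdivrMr// mul1r ler_pdivrMr ?ltr0n// -natrM ler_nat.
Qed.

End Compression.

(** * Block diagonal operators on the disjoint union *)

Local Open Scope classical_set_scope.
Local Open Scope complex_scope.
Local Open Scope card_scope.

Section BlockOperators.
Variable R : realType.

Lemma sqr_normc (z : R[i]) : normc z ^+ 2 = complex.Re z ^+ 2 + complex.Im z ^+ 2.
Proof. by case: z => a b /=; rewrite sqr_sqrtr ?addr_ge0 ?sqr_ge0. Qed.

(** A real kernel acts separately on real and imaginary parts, so its norm on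
    complex functions is its norm on real ones. *)
Lemma kop_complex (X : finType) (K : X -> X -> R) (c : R) (f : X -> R[i]) :
  0 <= c -> (forall g, nrm (kop K g) <= c * nrm g) ->
  \sum_x normc (\sum_y (K x y)%:C * f y) ^+ 2 <= c ^+ 2 * \sum_x normc (f x) ^+ 2.
Proof.
move=> c0 Kc.
have ReE x : complex.Re (\sum_y (K x y)%:C * f y) =
    kop K (fun y => complex.Re (f y)) x.
  rewrite /kop raddf_sum; apply: eq_bigr => y _ /=.
  by case: (f y) => a b /=; rewrite mul0r subr0.
have ImE x : complex.Im (\sum_y (K x y)%:C * f y) =
    kop K (fun y => complex.Im (f y)) x.
  rewrite /kop raddf_sum; apply: eq_bigr => y _ /=.
  by case: (f y) => a b /=; rewrite mul0r addr0.
under eq_bigr do rewrite sqr_normc ReE ImE.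
under [X in _ <= _ * X]eq_bigr do rewrite sqr_normc.
rewrite !big_split mulrDr /=; apply: lerD.
  by have := Kc (fun y => complex.Re (f y)); rewrite nrm_le.
by have := Kc (fun y => complex.Im (f y)); rewrite nrm_le.
Qed.

Local Notation V := {n : nat & 'I_n.+1}.

Lemma esum_blocks (a : V -> \bar R) : (forall v, 0 <= a v)%E ->
  (\esum_(v in [set: V]) a v =
   \esum_(n in [set: nat]) \sum_(i < n.+1) a (existT _ n i))%E.
Proof.
move=> a0.
pose B n : set V := [set existT (fun n => 'I_n.+1) n i | i in [set: 'I_n.+1]].
have -> : [set: V] = \bigcup_(n in [set: nat]) B n.
  by apply/seteqP; split=> // -[n i] _; exists n => //; exists i.
rewrite esum_bigcupT//; last first.
  by move=> n m _ _ [_ [[i _ <-]]] [j _ /(congr1 tag)].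
apply: eq_esum => n _; rewrite esum_image; last first.
  by move=> i j _ _; exact: existT_inj2.
rewrite esum_fset; [|exact: finite_finset|by move=> i _; exact: a0].
rewrite [RHS]fsbig_seq ?index_enum_uniq//; apply: eq_fsbigl.
by apply/seteqP; split=> i // _; rewrite /= mem_index_enum.
Qed.

Definition block_fun (K : forall n, 'I_n.+1 -> 'I_n.+1 -> R) (f : V -> R[i])
    (v : V) : R[i] :=
  \sum_j (K (tag v) (tagged v) j)%:C * f (existT _ (tag v) j).

Definition block_le (K : forall n, 'I_n.+1 -> 'I_n.+1 -> R) (c : R) :=
  forall n g, nrm (kop (K n) g) <= c * nrm g.

Lemma sqsum_block K (c : R) f : 0 <= c -> block_le K c ->
  (sqsum (block_fun K f) <= (c ^+ 2)%:E * sqsum f)%E.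
Proof.
move=> c0 Kc; rewrite /sqsum !esum_blocks; do ?by move=> v; rewrite lee_fin sqr_ge0.
apply: le_trans (esumZl (sqr_ge0 c) _); last first.
  by move=> n; apply: sume_ge0 => i _; rewrite lee_fin sqr_ge0.
apply: le_esum => n _; rewrite !sumEFin -EFinM lee_fin.
exact: (kop_complex (fun i : 'I_n.+1 => f (existT _ n i)) c0 (Kc n)).
Qed.

Lemma l2norm_block K (c : R) (T : l2 R V -> l2 R V) : 0 <= c -> block_le K c ->
  (forall f, l2_fun (T f) = block_fun K f) ->
  forall f, l2norm (T f) <= c * l2norm f.
Proof.
move=> c0 Kc TK f.
have fin g : sqsum (g : l2 R V) \is a fin_num.
  by rewrite ge0_fin_numE ?sqsum_ge0//; have := l2P g; rewrite unfold_in.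
have -> : c = Num.sqrt (c ^+ 2) by rewrite sqrtr_sqr ger0_norm.
rewrite /l2norm -sqrtrM ?sqr_ge0// ler_wsqrtr//.
by rewrite -lee_fin EFinM !fineK// TK; exact: sqsum_block.
Qed.

Lemma opnorm_block K (c : R) (T : l2 R V -> l2 R V) : 0 <= c -> block_le K c ->
  (forall f, l2_fun (T f) = block_fun K f) -> (opnorm T <= c%:E)%E.
Proof.
move=> c0 Kc TK; apply: ge_ereal_sup => _ [f /= f1 <-].
rewrite lee_fin; apply: le_trans (l2norm_block c0 Kc TK f) _.
by rewrite ler_piMr.
Qed.

Section BlockOperator.
Variables (K : forall n, 'I_n.+1 -> 'I_n.+1 -> R) (c : R).
Hypotheses (c0 : 0 <= c) (Kc : block_le K c).

Lemma block_subproof (f : l2 R V) : block_fun K f \in @l2_pred R V.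
Proof.
rewrite unfold_in; apply: le_lt_trans (sqsum_block _ c0 Kc) _.
by rewrite lte_mul_pinfty ?lee_fin ?sqr_ge0//; have := l2P f; rewrite unfold_in.
Qed.

Definition block_op (f : l2 R V) : l2 R V := L2 (block_subproof f).

Lemma block_op_is_linear : linear block_op.
Proof.
move=> a f g; apply: val_inj; apply/funext => v /=.
rewrite [RHS](_ : _ = a * block_fun K f v + block_fun K g v)//.
rewrite /block_fun mulr_sumr -big_split /=; apply: eq_bigr => j _.
set w := existT _ _ _.
rewrite [LHS](_ : _ = (K (tagged v) j)%:C * (a * f w + g w))//.
by rewrite mulrDr mulrCA.
Qed.

HB.instance Definition _ :=
  GRing.isLinear.Build R[i] (l2 R V) (l2 R V) _ block_op block_op_is_linear.

Lemma block_op_BB (d : nat) : (forall n, sparse_kernel d (@K n)) ->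
  BB_ d (block_op : {linear l2 R V -> l2 R V}).
Proof.
move=> Kd.
have coefE n i m j : mxcoef block_op (existT _ n i : V) (existT _ m j : V) != 0 ->
    exists2 k : 'I_n.+1, K i k != 0 & existT _ m j = existT _ n k :> V.
  rewrite /mxcoef /= /block_fun /=; apply: contra_neqP => /forall2NP E.
  rewrite big1// => k _; case: (E k) => [/negP/negPn/eqP ->|nk].
    by rewrite mul0r.
  by have /negPf -> : existT _ n k != existT _ m j :> V; rewrite ?mulr0//;
    apply/eqP => e; apply: nk.
have card_block n (A : {set 'I_n.+1}) (S : set V) : (#|A| <= d)%N ->
    (forall v, S v -> exists2 k, k \in A & v = existT _ n k) -> S #<= `I_d.
  move=> Ad SA.
  apply: (@card_le_trans _ _ _ ((fun k => existT _ n (nth ord0 (enum A) k)) @` `I_d)).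
    apply: subset_card_le => v /SA[k kA ->]; exists (index k (enum A)).
      by rewrite /= (leq_trans _ Ad)// cardE index_mem mem_enum.
    by rewrite nth_index ?mem_enum.
  exact: card_image_le.
split.
- by exists c => f; exact: l2norm_block.
- move=> [n i]; apply: (card_block n [set k | K i k != 0%R]%SET).
    by have [] := Kd n i.
  by move=> [m j] /= /coefE[k ik ->]; exists k; rewrite ?inE.
- move=> [m j]; apply: (card_block m [set k | K k j != 0%R]%SET).
    by have [] := Kd m j.
  move=> [n i] /= /coefE[k ik e].
  have mn : m = n by exact: existT_inj1 e.
  case: n / mn in i k ik e *.
  by exists i; rewrite // inE (existT_inj2 e).
Qed.

End BlockOperator.

End BlockOperators.

(** * The Laplacian of the union of complete graphs *)

Section CliqueLaplacian.
Variable R : realType.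
Local Notation GK := (disjoint_union (fun n : nat => complete_graph n.+1)).
Local Notation V := {n : nat & 'I_n.+1}.

Lemma big_nbhd (M : nmodType) n (i : 'I_n.+1) (F : V -> M) :
  \sum_(w \in nbhd (existT _ n i : GK)) F w =
  \sum_(j | j != i) F (existT _ n j).
Proof.
have -> : nbhd (existT _ n i : GK) =
    [set existT (fun n => 'I_n.+1) n j | j in [set j | j != i]].
  apply/seteqP; split=> [[m j] /andP[/= /eqP nm]|_ [j ji <-]].
    case: _ / nm in j *; rewrite tagged_asE => ij.
    by exists j; rewrite //= eq_sym.
  by rewrite /nbhd /= /union_adj /= eqxx tagged_asE /complete_adj eq_sym.
rewrite fsbig_image; last by move=> j k _ _; exact: existT_inj2.
rewrite [RHS](@bigfs _ _ _ _ (index_enum 'I_n.+1))//.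
  exact: index_enum_uniq.
by move=> j _; rewrite mem_index_enum.
Qed.

Lemma degree_clique (v : GK) : degree v = tag v.
Proof.
case: v => n i.
rewrite /degree card_fset_sum1 -[LHS](fsbig_finite _ (fun=> 1%N)); last first.
  exact: adj_finite.
rewrite [LHS](big_nbhd i (fun=> 1%N)) sum1_card cardC1 card_ord.
by [].
Qed.

(** Here [n] is the degree of the vertices of the clique. For [n = 0] the
    convention [0^-1 = 0] makes this the identity, which is the Laplacian of an
    isolated vertex. *)
Definition clique_kernel n (i j : 'I_n.+1) : R :=
  (1 + n%:R^-1) * (j == i)%:R - n%:R^-1.

Lemma laplacian_block (f : V -> R[i]) :
  laplacian_fun (G := GK) f = block_fun clique_kernel f.
Proof.
apply/funext => -[n i]; rewrite /laplacian_fun /normadj_fun /block_fun /=.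
rewrite (big_nbhd i (fun w : V => (Num.sqrt ((degree (existT _ n i : GK))%:R *
  (degree (w : GK))%:R))^-1%:C * f w)).
under [in LHS]eq_bigr => j _ do rewrite !degree_clique -expr2 sqrtr_sqr ger0_norm//.
rewrite [RHS](bigD1 i)//= /clique_kernel eqxx mulr1 addrK mul1r -sumrN.
congr (_ + _); apply: eq_bigr => j /negPf ->.
by rewrite mulr0 sub0r rmorphN mulNr.
Qed.

Lemma kop_clique n (g : 'I_n.+1 -> R) i :
  kop (@clique_kernel n) g i =
  (1 + n%:R^-1) * g i - (n.+1%:R * n%:R^-1) * mean g.
Proof.
rewrite /kop /clique_kernel; under eq_bigr do rewrite mulrBl.
rewrite sumrB; congr (_ - _); last first.
  by rewrite -mulr_sumr sum_mean card_ord mulrCA mulrA.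
rewrite (bigD1 i)//= eqxx mulr1 big1 ?addr0// => j /negPf ->.
by rewrite mulr0 mul0r.
Qed.

(** The kernel of the Laplacian with the mean on each clique replaced by [M]. *)
Definition sparsified (M : forall n, 'I_n.+1 -> 'I_n.+1 -> R) n
    (i j : 'I_n.+1) : R :=
  (1 + n%:R^-1) * (j == i)%:R - (n.+1%:R * n%:R^-1) * M n i j.

Lemma kop_sparsified M n (g : 'I_n.+1 -> R) i :
  kop (@sparsified M n) g i =
  (1 + n%:R^-1) * g i - (n.+1%:R * n%:R^-1) * kop (M n) g i.
Proof.
rewrite /kop /sparsified; under eq_bigr do rewrite mulrBl.
rewrite sumrB [in RHS]mulr_sumr; congr (_ - _); last first.
  by apply: eq_bigr => j _; rewrite mulrA.
rewrite (bigD1 i)//= eqxx mulr1 big1 ?addr0// => j /negPf ->.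
by rewrite mulr0 mul0r.
Qed.

Lemma sparsified_sparse M d n : sparse_kernel d (M n) ->
  sparse_kernel d.+1 (@sparsified M n).
Proof.
move=> Md i; have [r c] := Md i; split.
  apply: leq_trans (_ : #|i |: [set j | M n i j != 0%R]%SET| <= _)%N; last first.
    by rewrite cardsU1; exact: leq_add (leq_b1 _) r.
  apply: subset_leq_card; apply/fintype.subsetP => j; rewrite !inE.
  apply: contraNT; rewrite negb_or negbK => /andP[/negPf ji /eqP Mij].
  by rewrite /sparsified ji Mij !mulr0 subr0.
apply: leq_trans (_ : #|i |: [set j | M n j i != 0%R]%SET| <= _)%N; last first.
  by rewrite cardsU1; exact: leq_add (leq_b1 _) c.
apply: subset_leq_card; apply/fintype.subsetP => j; rewrite !inE.
apply: contraNT; rewrite negb_or negbK => /andP[/negPf ji /eqP Mij].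
by rewrite /sparsified [i == j]eq_sym ji Mij !mulr0 subr0.
Qed.

Lemma clique_ratio n : 0 <= (n.+1%:R : R) * n%:R^-1 <= 2.
Proof.
rewrite mulr_ge0 ?invr_ge0//=.
case: n => [|n]; first by rewrite invr0 mulr0.
by rewrite ler_pdivrMr ?ltr0n// -natrM ler_nat; lia.
Qed.

Lemma block_le_diff (M : forall n, 'I_n.+1 -> 'I_n.+1 -> R) (e : R) :
  (forall n g, nrm (fun i => kop (M n) g i - mean g) <= e * nrm g) ->
  block_le (fun n i j => clique_kernel i j - sparsified M i j) (2 * e).
Proof.
move=> Me n g; have /andP[r0 r2] := clique_ratio n.
have -> : kop (fun i j => clique_kernel i j - sparsified M i j) g =
    (fun i => (n.+1%:R * n%:R^-1) * (kop (M n) g i - mean g)).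
  apply/funext => i; rewrite /kop; under eq_bigr do rewrite mulrBl.
  rewrite sumrB -!/(kop _ g i) kop_clique kop_sparsified; ring.
rewrite nrmZ ger0_norm// -mulrA ler_pM ?nrm_ge0//.
Qed.

Lemma block_le_clique : block_le clique_kernel 4.
Proof.
move=> n g; have /andP[r0 r2] := clique_ratio n.
have -> : kop (@clique_kernel n) g = (fun i => (1 + n%:R^-1) * g i +
    (- (n.+1%:R * n%:R^-1)) * mean g).
  by apply/funext => i; rewrite kop_clique mulNr.
apply: le_trans (nrmD _ _) _; rewrite (nrmZ _ g) (nrmZ _ (fun=> mean g)) normrN.
have a0 : 0 <= n%:R^-1 :> R by rewrite invr_ge0.
have a1 : n%:R^-1 <= 1 :> R.
  by case: (n) => [|m]; rewrite ?invr0// invf_le1 ?ltr0n// ler1n.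
rewrite (ger0_norm r0) (ger0_norm (addr_ge0 ler01 a0)).
have -> : 4 = 2 + 2 :> R by lra.
rewrite [leRHS]mulrDl; apply: lerD.
  by rewrite ler_wpM2r ?nrm_ge0//; lra.
exact: ler_pM r0 (nrm_ge0 _) r2 (nrm_mean g).
Qed.

Lemma block_leB K K' (c c' : R) : block_le K c -> block_le K' c' ->
  block_le (fun n i j => K n i j - K' n i j) (c + c').
Proof.
move=> Kc Kc' n g.
have -> : kop (fun i j => K n i j - K' n i j) g =
    (fun i => kop (K n) g i + (-1) * kop (K' n) g i).
  apply/funext => i; rewrite /kop; under eq_bigr do rewrite mulrBl.
  by rewrite sumrB mulN1r.
apply: le_trans (nrmD _ _) _; rewrite nrmZ normrN1 mul1r mulrDl.
exact: lerD.
Qed.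

End CliqueLaplacian.

Theorem proposition5 (R : realType) :
  AULF R (disjoint_union (fun n : nat => complete_graph n.+1)).
Proof.
split; first exact: laplacian_bounded.
move=> e e0; have e4 : 0 < e / 4 by rewrite divr_gt0.
(* the mean enters with a coefficient at most 2, so e / 4 leaves an error e / 2 *)
have [d hd] := sparse_mean e4.
pose M n := sval (cid (hd n)).
have HM n : sparse_kernel d (M n) /\ forall g,
    nrm (fun i => kop (M n) g i - mean g) <= e / 4 * nrm g.
  exact: svalP (cid (hd n)).
have Md n : sparse_kernel d (M n) by case: (HM n).
have diff := block_le_diff (fun n => (HM n).2).
have c0 : 0 <= 2 * (e / 4) by rewrite mulr_ge0// ltW.
(* S = L - (L - S) is bounded, since L and L - S are *)
have Sc : block_le (sparsified M) (4 + 2 * (e / 4)).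
  move=> n; have -> : @sparsified R M n = fun i j : 'I_n.+1 =>
      clique_kernel R i j - (clique_kernel R i j - sparsified M i j).
    by apply/funext => i; apply/funext => j; rewrite subKr.
  exact: block_leB (@block_le_clique R) diff n.
have Sc0 : 0 <= 4 + 2 * (e / 4) by rewrite addr_ge0.
exists (block_op Sc0 Sc).
  exists d.+1 => //; apply: block_op_BB => n; exact: sparsified_sparse.
apply: (@le_lt_trans _ _ (2 * (e / 4))%:E); last by rewrite lte_fin; lra.
apply: (opnorm_block c0 diff) => f.
apply/funext => v.
rewrite [LHS](_ : _ = laplacian_fun (G := disjoint_union (fun n : nat => complete_graph n.+1))
  (l2_fun f) v - block_fun (sparsified M) (l2_fun f) v)//.
rewrite laplacian_block /block_fun -sumrB; apply: eq_bigr => j _.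
by rewrite -mulrBl -rmorphB.
Qed.
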